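(* Let $t\geq 1$, let $r_1,\ldots,r_t$ be positive integers with $\gcd(r_i,r_j)=1$ for all $i\neq j$, and let $C_i=\langle x_i\mid x_i^{r_i}\rangle\cong\mathbb{Z}_{r_i}$ for $1\leq i\leq t$. Then for all $c\geq 1$, $$M^{(c)}\Big(C_1*C_2*\cdots*C_t\Big)\cong\bigoplus_{i=1}^{t}M^{(c)}(C_i)=1,$$ where $C_1*\cdots*C_t$ is the free product of the $C_i$.
   Context: For a group $G$ with a free presentation $1\to R\to F\to G\to 1$ ($F$ free, $R\trianglelefteq F$), and an integer $c\geq 1$, the $c$-nilpotent multiplier of $G$ (the Baer-invariant of $G$ with respect to the variety of nilpotent groups of class at most $c$) is $M^{(c)}(G)=\dfrac{R\cap \gamma_{c+1}(F)}{[R,\,_cF]}$, where $\gamma_{k}(F)$ is the $k$-th term of the lower central series of $F$ ($\gamma_1(F)=F$, $\gamma_{k+1}(F)=[\gamma_k(F),F]$), $[R,\,_1F]=[R,F]$ and $[R,\,_cF]=[[R,\,_{c-1}F],F]$. This group is abelian and, up to isomorphism, independent of the chosen free presentation. *)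

(* Defs.v *)
(* A concrete model of the free group F_t on
   generators x_0..x_{t-1} as reduced words, subgroups as predicates. *)
From mathcomp Require Import all_boot.
Set Implicit Arguments. Unset Strict Implicit. Unset Printing Implicit Defensive.

Section FreeGroup.
Variable t : nat.

(* a letter (i, false) is x_i, (i, true) is x_i^-1 *)
Definition letter := ('I_t * bool)%type.
Definition word := seq letter.

Definition inverse_letters (a b : letter) : bool := (a.1 == b.1) && (a.2 == ~~ b.2).

Fixpoint reduced (w : word) : bool :=
  match w with
  | a :: ((b :: _) as w') => ~~ inverse_letters a b && reduced w'
  | _ => true
  end.

Definition push (a : letter) (w : word) : word :=
  match w with
  | b :: w' => if inverse_letters a b then w' else a :: w
  | [::] => [:: a]
  end.

(* group operations on reduced words (results are always reduced) *)
Definition fmul (u v : word) : word := foldr push v u.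
Definition fnorm (w : word) : word := fmul w [::].
Definition flip (a : letter) : letter := (a.1, ~~ a.2).
Definition finv (u : word) : word := fnorm (map flip (rev u)).
Definition fcomm (u v : word) : word := fmul (finv u) (fmul (finv v) (fmul u v)).
Definition fconj (u g : word) : word := fmul (finv g) (fmul u g).

Definition Ffull : word -> Prop := fun w => reduced w.

(* subgroup generated by a set of (possibly unreduced) words *)
Inductive gen (S : word -> Prop) : word -> Prop :=
| gen_base w : S w -> gen S (fnorm w)
| gen_one : gen S [::]
| gen_mul u v : gen S u -> gen S v -> gen S (fmul u v)
| gen_inv u : gen S u -> gen S (finv u).

Definition commsub (A B : word -> Prop) : word -> Prop :=
  gen (fun w => exists u v, A u /\ B v /\ w = fcomm u v).

(* lower central series: gamma 1 = F, gamma (k+1) = [gamma k, F] *)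
Fixpoint gamma_aux (n : nat) : word -> Prop :=
  match n with
  | 0 => Ffull
  | n'.+1 => commsub (gamma_aux n') Ffull
  end.
Definition gamma (k : nat) : word -> Prop := gamma_aux k.-1.

Fixpoint itcomm (R : word -> Prop) (c : nat) : word -> Prop :=
  match c with
  | 0 => R
  | c'.+1 => commsub (itcomm R c') Ffull
  end.

Definition normal_closure (S : word -> Prop) : word -> Prop :=
  gen (fun w => exists s g, S s /\ Ffull g /\ w = fconj s g).

Definition relators (r : 'I_t -> nat) : word -> Prop :=
  fun w => exists i : 'I_t, w = nseq (r i) (i, false).

(* R = normal closure of {x_i^{r_i}} in F, so F/R = C_1 * ... * C_t *)
Definition Rrel (r : 'I_t -> nat) : word -> Prop := normal_closure (relators r).

(* M^(c)(G) = (R ∩ gamma_{c+1}(F)) / [R, _c F] is trivial, for the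
   presentation 1 -> R -> F_t -> G -> 1 of G = C_1 * ... * C_t.
   Since [R,_cF] <= R ∩ gamma_{c+1}(F) always, triviality is the inclusion. *)
Definition cnil_multiplier_trivial (r : 'I_t -> nat) (c : nat) : Prop :=
  forall w, Rrel r w -> gamma c.+1 w -> itcomm (Rrel r) c w.

End FreeGroup.

(* Main.v *)
Require Import Defs.
From mathcomp Require Import all_boot.
From HB Require Import structures.

(**
  Write [R,_k F] for the iterated commutators of the normal closure R of the
  powers x_i^(r_i), and let phi_m be the endomorphism x_i |-> x_i^m of F.
  Commutators are bilinear modulo the next term, so phi_m acts on the abelian
  group [R,_k F] / [R,_(k+1) F] as the power map of exponent m^(k+1).
  For m = m_i := prod_(j <> i) r_j, all the x_j^m with j <> i lie in R, so the
  image of phi_m is abelian modulo [R,F], and phi_m maps gamma_(c+1)(F) into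
  [R,_c F].  Let w lie in R and in gamma_(c+1)(F).  By induction on c it lies
  in [R,_(c-1) F], hence w^(m_i^c) lies in [R,_c F] for every i.  Pairwise
  coprimality makes the gcd of the m_i^c equal to 1, so w lies in [R,_c F].
*)

Set Implicit Arguments.
Unset Strict Implicit.
Unset Printing Implicit Defensive.

(** * Arithmetic of the exponents m_i *)

Lemma biggcd_prod_coprime (I : finType) (r : I -> nat) n (i0 : I) :
    (forall i j, i != j -> coprime (r i) (r j)) ->
  \big[gcdn/0]_i (\prod_(j | j != i) r j) ^ n = 1.
Proof.
move=> co_r; apply/eqP/negPn/negP => gcd_neq1.
set d := \big[gcdn/0]_i _ in gcd_neq1.
have [p pr_p p_d] : exists2 p, prime p & p %| d.
  (* If d = 0 every prime divides it, so 2 serves. *)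
  case: (posnP d) => [->|d_gt0]; first by exists 2.
  exists (pdiv d); last exact: pdiv_dvd.
  by apply: pdiv_prime; rewrite ltn_neqAle eq_sym gcd_neq1.
(* For each i, p divides the i-th product, hence some r j with j different from i. Applying this at
   [i0] and then at the index found gives two distinct indices whose r-values p divides. *)
have other i : exists2 j, j != i & p %| r j.
  have /dvdn_biggcdP/(_ i isT) := p_d.
  rewrite Euclid_dvdX // Euclid_dvd_prod // big_orE => /andP[/existsP[j]].
  by case/andP=> ji pj _; exists j.
have [j _ pj] := other i0; have [k kj pk] := other j.
have := dvdn_gcd p (r k) (r j).
by rewrite (eqnP (co_r _ _ kj)) pj pk Euclid_dvd1.
Qed.

(** * Normal subgroups, iterated commutators and congruences *)

Section GroupTheory.
Local Open Scope group_scope.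
Variable G : groupType.
Implicit Types (S A N R : G -> Prop) (a b g h x y z : G).

Lemma commgMl x y z : [~ x * y, z] = [~ x, z] ^ y * [~ y, z].
Proof. by rewrite /commg /conjg !invgM !mulgA !(mulgK, mulgVK). Qed.

Lemma commgMr x y z : [~ x, y * z] = [~ x, z] * [~ x, y] ^ z.
Proof. by rewrite /commg /conjg !invgM !mulgA !(mulgK, mulgVK). Qed.

Inductive generated S : G -> Prop :=
| generated_base x : S x -> generated S x
| generated1 : generated S 1
| generatedM x y : generated S x -> generated S y -> generated S (x * y)
| generatedV x : generated S x -> generated S x^-1.

Record normal_subgroup N : Prop := NormalSubgroup {
  normal1 : N 1;
  normalM : forall x y, N x -> N y -> N (x * y);
  normalV : forall x, N x -> N x^-1;
  normalJ : forall x y, N x -> N (x ^ y) }.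

Lemma generated_normal S :
  (forall x y, S x -> S (x ^ y)) -> normal_subgroup (generated S).
Proof.
move=> SJ; split; [exact: generated1|exact: generatedM|exact: generatedV|].
move=> x y; elim=> {x} [x Sx||x z _ IHx _ IHz|x _ IHx].
- exact/generated_base/SJ.
- by rewrite conj1g; apply: generated1.
- by rewrite conjMg; apply: generatedM.
- by rewrite conjVg; apply: generatedV.
Qed.

Lemma generated_sub S N :
  normal_subgroup N -> (forall x, S x -> N x) -> forall x, generated S x -> N x.
Proof.
move=> nN sSN x; elim=> {x} [x /sSN//||x z _ IHx _ IHz|x _ IHx].
- exact: normal1.
- exact: normalM.
- exact: normalV.
Qed.

Definition commT A := generated (fun g => exists a h, A a /\ g = [~ a, h]).

Fixpoint iter_commT R k := if k is k'.+1 then commT (iter_commT R k') else R.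

Lemma commT_mem A a g : A a -> commT A [~ a, g].
Proof. by move=> Aa; apply: generated_base; exists a, g. Qed.

Lemma commT_normal A : normal_subgroup A -> normal_subgroup (commT A).
Proof.
move=> nA; apply: generated_normal => _ y [a [h [Aa ->]]].
by exists (a ^ y), (h ^ y); split; [apply: normalJ|rewrite conjRg].
Qed.

Lemma commT_sub A : normal_subgroup A -> forall x, commT A x -> A x.
Proof.
move=> nA; apply: generated_sub => // _ [a [h [Aa ->]]].
by apply: normalM => //; [apply: normalV|apply: normalJ].
Qed.

Lemma iter_commT_normal R k :
  normal_subgroup R -> normal_subgroup (iter_commT R k).
Proof. by move=> nR; elim: k => //= k; apply: commT_normal. Qed.

Definition eqm N x y := N (x^-1 * y).

Section Congruence.
Variable N : G -> Prop.
Hypothesis nN : normal_subgroup N.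

Lemma eqm_refl x : eqm N x x.
Proof. by rewrite /eqm mulVg; apply: normal1. Qed.

Lemma eqm_sym x y : eqm N x y -> eqm N y x.
Proof. by move=> /(normalV nN); rewrite /eqm invgM invgK. Qed.

Lemma eqm_trans y x z : eqm N x y -> eqm N y z -> eqm N x z.
Proof. by move=> xy /(normalM nN xy); rewrite /eqm mulgA mulgK. Qed.

Lemma eqmM x x' y y' : eqm N x x' -> eqm N y y' -> eqm N (x * y) (x' * y').
Proof.
move=> /(normalJ nN y) xx' /(normalM nN xx').
by rewrite /eqm /conjg invgM !mulgA mulgK.
Qed.

Lemma eqmV x y : eqm N x y -> eqm N x^-1 y^-1.
Proof.
move=> /(normalV nN)/(normalJ nN y^-1).
by rewrite /eqm /conjg invgM !invgK !mulgA mulgV mul1g.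
Qed.

Lemma eqmX n x y : eqm N x y -> eqm N (x ^+ n) (y ^+ n).
Proof.
move=> xy; elim: n => [|n IHn]; first exact: eqm_refl.
by rewrite !expgS; apply: eqmM.
Qed.

Lemma eqm_mem x y : eqm N x y -> N x -> N y.
Proof. by move=> xy /normalM-/(_ nN _ xy); rewrite mulVKg. Qed.

Lemma normalX n x : N x -> N (x ^+ n).
Proof.
move=> Nx; elim: n => [|n IHn]; first exact: normal1.
by rewrite expgS; apply: normalM.
Qed.

Lemma mem_commC x y : N [~ x, y] -> N [~ y, x].
Proof. by move=> /(normalV nN); rewrite invgR. Qed.

Lemma mem_commM x y z : N [~ x, z] -> N [~ y, z] -> N [~ x * y, z].
Proof. by move=> Nx Ny; rewrite commgMl; apply: normalM => //; apply: normalJ. Qed.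

Lemma mem_commV x z : N [~ x, z] -> N [~ x^-1, z].
Proof.
move=> /(normalV nN)/(normalJ nN x^-1); rewrite conjVg.
have := commgMl x x^-1 z; rewrite mulgV comm1g => /esym/mulg1_eq.
by move=> ->.
Qed.

Lemma normal_gcd x m n : N (x ^+ m) -> N (x ^+ n) -> N (x ^+ gcdn m n).
Proof.
have [->|m_gt0] := posnP m; first by rewrite gcd0n.
(* Bezout without subtraction: u m = v n + gcd(m, n), so the wanted power is x^(-v n) x^(u m). *)
move=> Nm Nn; have [u v uv _] := egcdnP n m_gt0.
have /(normalM nN) : N (x ^+ (v * n))^-1.
  by apply: normalV => //; rewrite mulnC expgnA; apply: normalX.
move=> /(_ (x ^+ (u * m))); rewrite uv expgnDr mulKg; apply.
by rewrite -expgnDr -uv mulnC expgnA; apply: normalX.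
Qed.

End Congruence.

(** * A/[A,G] is central in G/[A,G] *)

Section CentralQuotient.
Variable A : G -> Prop.
Hypothesis nA : normal_subgroup A.
Let nN := commT_normal nA.
Let nN2 := commT_normal nN.

(** The quotient a^-1 a^g is the commutator [a,g] itself. *)
Lemma commT_eqJ a g : A a -> eqm (commT A) (a ^ g) a.
Proof. by move=> Aa; apply/(eqm_sym nN)/commT_mem. Qed.

Lemma commT_eqC a g : A a -> eqm (commT A) (a * g) (g * a).
Proof.
move=> Aa; rewrite conjgC; apply: (eqmM nN); first exact: eqm_refl.
exact: commT_eqJ.
Qed.

Lemma commT_eqX n a g : A a ->
  eqm (commT A) ((a * g) ^+ n) (a ^+ n * g ^+ n).
Proof.
move=> Aa; elim: n => [|n IHn]; first by rewrite !expg0 mulg1; apply: eqm_refl.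
rewrite !expgS; apply: (eqm_trans nN (y := a * g * (a ^+ n * g ^+ n))).
  by apply: (eqmM nN); [apply: eqm_refl|].
rewrite -!mulgA; apply: (eqmM nN); first exact: eqm_refl.
rewrite !mulgA; apply: (eqmM nN); last exact: eqm_refl.
apply: eqm_sym => //; apply: commT_eqC; exact: normalX.
Qed.

End CentralQuotient.

(** * Commutators with A are bilinear modulo [[A,G],G] *)

Section BilinearCommutator.
Variable A : G -> Prop.
Hypothesis nA : normal_subgroup A.
Let nN := commT_normal nA.
Let nN2 := commT_normal nN.

(** The exact identity has [a,g]^b as first factor; the conjugation disappears because [A,G] is
    central modulo [[A,G],G]. *)
Lemma commT_eqRMl a b g : A a ->
  eqm (commT (commT A)) [~ a * b, g] ([~ a, g] * [~ b, g]).
Proof.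
move=> Aa; rewrite commgMl; apply: (eqmM nN2); last exact: eqm_refl.
exact/(commT_eqJ nN)/commT_mem.
Qed.

Lemma commT_eqRMr a g h : A a ->
  eqm (commT (commT A)) [~ a, g * h] ([~ a, g] * [~ a, h]).
Proof.
move=> Aa; rewrite commgMr.
apply: (eqm_trans nN2 (y := [~ a, h] * [~ a, g])).
  apply: (eqmM nN2); first exact: eqm_refl.
  exact/(commT_eqJ nN)/commT_mem.
exact/(commT_eqC nN)/commT_mem.
Qed.

Lemma commT_eqRXl n a g : A a ->
  eqm (commT (commT A)) [~ a ^+ n, g] ([~ a, g] ^+ n).
Proof.
move=> Aa; elim: n => [|n IHn].
  by rewrite !expg0 comm1g; apply: eqm_refl.
rewrite !expgS; apply: (eqm_trans nN2 (commT_eqRMl _ _ Aa)).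
by apply: (eqmM nN2) IHn; apply: eqm_refl.
Qed.

Lemma commT_eqRXr n a g : A a ->
  eqm (commT (commT A)) [~ a, g ^+ n] ([~ a, g] ^+ n).
Proof.
move=> Aa; elim: n => [|n IHn].
  by rewrite !expg0 commg1; apply: eqm_refl.
rewrite !expgS; apply: (eqm_trans nN2 (commT_eqRMr _ _ Aa)).
by apply: (eqmM nN2) IHn; apply: eqm_refl.
Qed.

(** Write b = a (a^-1 b): the second factor lies in [A,G], so its commutator with g is trivial
    modulo [[A,G],G]. *)
Lemma commT_eqRl a b g : A a -> eqm (commT A) a b ->
  eqm (commT (commT A)) [~ a, g] [~ b, g].
Proof.
move=> Aa ab; apply: (eqm_sym nN2); rewrite -[b](mulVKg a).
apply: (eqm_trans nN2 (commT_eqRMl _ _ Aa)).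
rewrite -[X in eqm _ _ X]mulg1; apply: (eqmM nN2); first exact: eqm_refl.
by apply: (eqm_sym nN2); rewrite /eqm invg1 mul1g; apply: commT_mem.
Qed.

End BilinearCommutator.

(** * The endomorphism raising each generator to the power m *)

Section PowerEndomorphism.
Variables (I : Type) (x : I -> G).
(** The x i generate G; the form is that of an induction on words, letter by letter from the
    left. *)
Hypothesis gen_ind : forall P : G -> Prop, P 1 ->
  (forall i g, P g -> P (x i * g)) -> (forall i g, P g -> P ((x i)^-1 * g)) ->
  forall g, P g.
Variables (phi : UMagmaMorphism.type G G) (m : nat).
Hypothesis phi_x : forall i, phi (x i) = x i ^+ m.

Lemma phi_xV i : phi (x i)^-1 = (x i)^-1 ^+ m.
Proof. by rewrite gmulfV phi_x expVgn. Qed.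

(** In general phi g is not g^m modulo anything useful, but inside [a, -] it may be treated so:
    modulo [[A,G],G] both sides are homomorphisms in g to an abelian group, and they agree on
    generators. *)
Lemma commT_eq_phi A a g : normal_subgroup A -> A a ->
  eqm (commT (commT A)) [~ a, phi g] ([~ a, g] ^+ m).
Proof.
move=> nA Aa; have nN := commT_normal nA; have nN2 := commT_normal nN.
have step y h : phi y = y ^+ m ->
    eqm (commT (commT A)) [~ a, phi h] ([~ a, h] ^+ m) ->
    eqm (commT (commT A)) [~ a, phi (y * h)] ([~ a, y * h] ^+ m).
  move=> phi_y IHh; rewrite gmulfM phi_y.
  apply: (eqm_trans nN2 (commT_eqRMr nA _ _ Aa)).
  apply: (eqm_trans nN2 (eqmM nN2 (commT_eqRXr nA _ _ Aa) IHh)).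
  apply: (eqm_sym nN2).
  apply: (eqm_trans nN2 (eqmX nN2 _ (commT_eqRMr nA _ _ Aa))).
  exact/(commT_eqX nN)/commT_mem.
elim/gen_ind: g => [|i g|i g].
- by rewrite gmulf1 commg1 expg1n; apply: eqm_refl.
- exact/step/phi_x.
- exact/step/phi_xV.
Qed.

Variable r : I -> nat.

Definition power_closure := generated (fun g => exists i h, g = (x i ^+ r i) ^ h).

Local Notation R := power_closure.

Lemma power_closure_normal : normal_subgroup R.
Proof.
apply: generated_normal => _ y [i [h ->]].
by exists i, (h * y); rewrite conjgM.
Qed.

Let nR := power_closure_normal.

Lemma power_closure_mem i n : r i %| n -> R (x i ^+ n).
Proof.
case/dvdnP=> q ->; rewrite mulnC expgnA; apply: (normalX nR).
by apply: generated_base; exists i, 1; rewrite conjg1.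
Qed.

(** One factor m comes from R and one from each further commutator entry: [phi a, phi f] is
    congruent to [a^(m^(k+1)), phi f], then to [a, phi f]^(m^(k+1)), then to [a,f]^(m^(k+2)). *)
Lemma iter_commT_phi k v : iter_commT R k v ->
  eqm (iter_commT R k.+1) (phi v) (v ^+ (m ^ k.+1)).
Proof.
have closeM A n u w : normal_subgroup A -> A u ->
    eqm (commT A) (phi u) (u ^+ n) -> eqm (commT A) (phi w) (w ^+ n) ->
    eqm (commT A) (phi (u * w)) ((u * w) ^+ n).
  move=> nA Au phi_u phi_w; have nN := commT_normal nA.
  rewrite gmulfM; apply: (eqm_trans nN (eqmM nN phi_u phi_w)).
  exact/(eqm_sym nN)/commT_eqX.
have closeV A n u : normal_subgroup A ->
    eqm (commT A) (phi u) (u ^+ n) -> eqm (commT A) (phi u^-1) (u^-1 ^+ n).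
  move=> nA phi_u; rewrite gmulfV expVgn.
  by apply: eqmV phi_u; apply: commT_normal.
elim: k v => [|k IHk] v.
  have nN := commT_normal nR; rewrite /= expn1.
  elim=> {v} [_ [i [h ->]]||u w Ru IHu Rw IHw|u Ru IHu].
  (* Both sides are conjugates of x_i^(r_i m), which is central modulo [R,G]. *)
  - rewrite gmulfJ gmulfXn phi_x expgnAC -conjXg.
    have Rx : R ((x i ^+ r i) ^+ m).
      by rewrite -expgnA; apply/power_closure_mem/dvdn_mulr.
    apply: (eqm_trans nN (commT_eqJ nR _ Rx)).
    exact/(eqm_sym nN)/(commT_eqJ nR).
  - by rewrite gmulf1 expg1n; apply: eqm_refl.
  - exact: closeM.
  - exact: closeV.
have nA := iter_commT_normal k nR.
have nN : normal_subgroup (iter_commT R k.+1) := commT_normal nA.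
have nN2 := commT_normal nN.
rewrite -[iter_commT R k.+2]/(commT (iter_commT R k.+1)).
elim=> {v} [_ [a [f [Aa ->]]]||u w Ru IHu Rw IHw|u Ru IHu].
- rewrite gmulfR expnS expgnA.
  (* Invariance of the term under phi also follows from the induction hypothesis: phi a is congruent
     to a power of a modulo a smaller subgroup. *)
  have Aphi : iter_commT R k (phi a).
    apply: (eqm_mem nA (x := a ^+ (m ^ k.+1))); last exact: normalX.
    exact/(commT_sub nA)/(eqm_sym nN)/IHk.
  apply: (eqm_trans nN2 (commT_eqRl nA _ Aphi (IHk _ Aa))).
  apply: (eqm_trans nN2 (commT_eqRXl nA _ _ Aa)).
  exact/(eqmX nN2)/commT_eq_phi.
- by rewrite gmulf1 expg1n; apply: eqm_refl.
- exact: closeM.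
- exact: closeV.
Qed.

(** The image of phi is generated by the x_i^m, hence abelian modulo [R,G]. So phi sends gamma_2
    into [R,G], and each further commutator adds one step on both sides. *)
Lemma phi_lower_central k g :
    (forall i j, commT R [~ x i ^+ m, x j ^+ m]) ->
  iter_commT (fun=> True) k.+1 g -> iter_commT R k.+1 (phi g).
Proof.
move=> comm_x; have nN := commT_normal nR.
have comm_z z : (forall i, commT R [~ phi (x i), z]) ->
    forall h, commT R [~ phi h, z].
  move=> comm_xz; elim/gen_ind => [|i h IHh|i h IHh].
  - by rewrite gmulf1 comm1g; apply: normal1.
  - by rewrite gmulfM /=; apply: (mem_commM nN).
  - by rewrite gmulfM gmulfV /=; apply: (mem_commM nN) => //; apply: mem_commV.
have comm_phi h f : commT R [~ phi h, phi f].
  (* Extend from generators to all elements in one entry, swap the entries, and extend in the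
     other. *)
  apply: (comm_z) => i; apply: (mem_commC nN); apply: (comm_z) => j.
  by rewrite !phi_x.
have step n A : (forall a f, A a -> iter_commT R n.+1 [~ phi a, phi f]) ->
    forall v, commT A v -> iter_commT R n.+1 (phi v).
  move=> phiR v; elim=> {v} [_ [a [f [Aa ->]]]||u w _ IHu _ IHw|u _ IHu].
  - by rewrite gmulfR; apply: phiR.
  - by rewrite gmulf1; apply: normal1 (iter_commT_normal n.+1 nR).
  - by rewrite gmulfM; apply: normalM (iter_commT_normal n.+1 nR) _ _ IHu IHw.
  - by rewrite gmulfV; apply: normalV (iter_commT_normal n.+1 nR) _ IHu.
elim: k g => [|k IHk] g; first by apply: (step 0) => a f _; apply: comm_phi.
by apply: step => a f /IHk; apply: commT_mem.
Qed.

End PowerEndomorphism.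

(** Freeness enters through generation by the x i and the existence of the power endomorphisms. The
    index [i0] excludes the empty gcd, which is 0. *)
Theorem power_closure_lower_central (I : finType) (x : I -> G) (r : I -> nat)
    (i0 : I) :
    (forall P : G -> Prop, P 1 -> (forall i g, P g -> P (x i * g)) ->
       (forall i g, P g -> P ((x i)^-1 * g)) -> forall g, P g) ->
    (forall m, exists phi : UMagmaMorphism.type G G,
       forall i, phi (x i) = x i ^+ m) ->
    (forall i j, i != j -> coprime (r i) (r j)) ->
  forall c w, power_closure x r w -> iter_commT (fun=> True) c w ->
  iter_commT (power_closure x r) c w.
Proof.
move=> gen_ind powE co_r; elim=> [//|c IHc] w Rw w_lc.
have nR := power_closure_normal x r.
have nN := iter_commT_normal c.+1 nR.
have Aw : iter_commT (power_closure x r) c w.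
  apply: IHc => //; move: w_lc; apply: commT_sub.
  exact: iter_commT_normal.
suff: iter_commT (power_closure x r) c.+1
    (w ^+ (\big[gcdn/0]_i (\prod_(j | j != i) r j) ^ c.+1)%N).
  by rewrite biggcd_prod_coprime.
(* The exponents n with w^n in the subgroup contain 0, the value of an empty gcd, and are closed
   under gcd, so each index i can be treated separately. *)
apply: (big_ind (fun n => iter_commT (power_closure x r) c.+1 (w ^+ n))).
- by rewrite expg0; apply: normal1.
- by move=> m n; apply: normal_gcd.
move=> i _; set m := (\prod_(j | _) _)%N.
have [phi phi_x] := powE m.
apply: (eqm_mem nN (iter_commT_phi gen_ind phi_x Aw)).
apply: (phi_lower_central gen_ind phi_x _ w_lc) => j k.
(* For l different from i, r l is a factor of m, so x_l^m lies in R. The only pair with neither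
   entry in R is (i, i), whose commutator is 1. *)
have commR l g : l != i -> commT (power_closure x r) [~ x l ^+ m, g].
  move=> li; apply/commT_mem/power_closure_mem.
  by rewrite /m (bigD1 l) //= dvdn_mulr.
have [->|ji] := eqVneq j i; last exact: commR.
have [->|ki] := eqVneq k i.
  by rewrite commgg; apply: normal1 (commT_normal nR).
exact/(mem_commC (commT_normal nR))/commR.
Qed.

End GroupTheory.

(** * Reduced words form a group *)

Section FreeGroup.
Local Open Scope group_scope.
Variable t : nat.
Implicit Types (a b : letter t) (u v w : word t).

Lemma inverse_lettersE a b : inverse_letters a b = (a == flip b).
Proof. by case: a b => i e [j f]. Qed.

Lemma flipK : involutive (@flip t).
Proof. by case=> i e; rewrite /flip /= negbK. Qed.

Lemma reduced_behead a w : reduced (a :: w) -> reduced w.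
Proof. by case: w => //= b w /andP[]. Qed.

Lemma push_reduced a w : reduced w -> reduced (push a w).
Proof.
case: w => // b w Rbw; rewrite /push; case: ifP => [_|ab].
  exact: reduced_behead Rbw.
by apply/andP; rewrite ab.
Qed.

Lemma push_cons a w : reduced (a :: w) -> push a w = a :: w.
Proof. by case: w => //= b w /andP[/negPf->]. Qed.

(** Each letter acts on reduced words by a permutation, with the flipped letter as its inverse; the
    group laws rest on this. *)
Lemma pushK a w : reduced w -> push (flip a) (push a w) = w.
Proof.
case: w => [|b w] /=; first by rewrite inverse_lettersE eqxx.
rewrite inverse_lettersE; case: eqP => [-> Rbw|_ _ /=].
  by rewrite flipK push_cons.
by rewrite inverse_lettersE eqxx.
Qed.

Lemma fmul_reduced u v : reduced v -> reduced (fmul u v).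
Proof. by move=> Rv; elim: u => //= a u; apply: push_reduced. Qed.

(** If [a] cancels the head of u, then on the right it meets its own inverse action, and [pushK]
    applies. Associativity follows letter by letter. *)
Lemma fmul_push a u w : reduced w -> fmul (push a u) w = push a (fmul u w).
Proof.
move=> Rw; case: u => //= b u; case: ifP => //.
rewrite inverse_lettersE => /eqP->; rewrite pushK //; exact: fmul_reduced.
Qed.

Lemma fmulA u v w : reduced w -> fmul u (fmul v w) = fmul (fmul u v) w.
Proof. by move=> Rw; elim: u => //= a u ->; rewrite fmul_push. Qed.

Lemma fmul_nil w : reduced w -> fmul w [::] = w.
Proof.
elim: w => // a w IHw Raw; rewrite -[LHS]/(push a (fmul w [::])).
by rewrite IHw ?push_cons //; apply: reduced_behead Raw.
Qed.

Lemma fmul_flip_rev u v : reduced v ->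
  fmul (map (@flip t) (rev u)) (fmul u v) = v.
Proof.
elim: u v => [//|a u IHu] v Rv; rewrite rev_cons map_rcons.
rewrite [LHS]foldr_rcons -[fmul (a :: u) v]/(push a (fmul u v)).
by rewrite pushK ?[LHS]IHu //; apply: fmul_reduced.
Qed.

Lemma fmulV u : reduced u -> fmul (Defs.finv u) u = [::].
Proof.
move=> Ru; rewrite /Defs.finv /fnorm -fmulA //= -{2}[u]fmul_nil //.
exact: fmul_flip_rev.
Qed.

Definition fgroup := {w : word t | reduced w}.
HB.instance Definition _ := Choice.on fgroup.

Definition fone : fgroup := Sub [::] isT.
Definition fgmul (g h : fgroup) : fgroup :=
  Sub (fmul (val g) (val h)) (fmul_reduced _ (valP h)).
Definition fginv (g : fgroup) : fgroup :=
  Sub (Defs.finv (val g)) (fmul_reduced (v := [::]) _ isT).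

Lemma fgmulA : associative fgmul.
Proof. by move=> g h k; apply/val_inj/fmulA/valP. Qed.

Lemma fgmul1g : left_id fone fgmul.
Proof. by move=> g; apply: val_inj. Qed.

Lemma fgmulg1 : right_id fone fgmul.
Proof. by move=> g; apply/val_inj/fmul_nil/valP. Qed.

Lemma fgmulVg : left_inverse fone fginv fgmul.
Proof. by move=> g; apply/val_inj/fmulV/valP. Qed.

Lemma fgmulgV : right_inverse fone fginv fgmul.
Proof.
(* Insert (g^-1)^-1 g^-1 = 1 in front of g g^-1 and cancel the middle pair. *)
move=> g; rewrite -[LHS]fgmul1g -{1}(fgmulVg (fginv g)) -!fgmulA.
by rewrite (fgmulA (fginv g)) fgmulVg fgmul1g fgmulVg.
Qed.

HB.instance Definition _ := isGroup.Build fgroup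
  fgmulA fgmul1g fgmulg1 fgmulVg fgmulgV.

Definition fgen (i : 'I_t) : fgroup := Sub [:: (i, false)] isT.

Lemma fgen_ind (P : fgroup -> Prop) : P 1 ->
  (forall i g, P g -> P (fgen i * g)) ->
  (forall i g, P g -> P ((fgen i)^-1 * g)) ->
  forall g, P g.
Proof.
move=> P1 Px PV g; move: {-1}(val g) (erefl (val g)) => w.
elim: w g => [|a w IHw] g gw; first by have -> : g = 1 by apply: val_inj.
have Raw : reduced (a :: w) by rewrite -gw; apply: valP.
pose h : fgroup := Sub w (reduced_behead Raw).
have Ph : P h by apply: IHw.
(* For a reduced word, prepending the letter is the same as multiplying by the generator or its
   inverse. *)
move: gw; rewrite -push_cons //; case: a Raw @h Ph => i [] Raw h Ph gw.
- have -> : g = (fgen i)^-1 * h by apply: val_inj.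
  exact: PV.
- have -> : g = fgen i * h by apply: val_inj.
  exact: Px.
Qed.

(** * Universal property, the source of the power endomorphisms *)

Section Lift.
Variables (H : groupType) (y : 'I_t -> H).

Definition letter_lift a : H := if a.2 then (y a.1)^-1 else y a.1.
Definition word_lift w : H := foldr (fun a h => letter_lift a * h) 1 w.
Definition flift (g : fgroup) : H := word_lift (val g).

Lemma letter_lift_flip a : letter_lift (flip a) = (letter_lift a)^-1.
Proof. by case: a => i []; rewrite /letter_lift //= invgK. Qed.

Lemma word_lift_push a w : word_lift (push a w) = letter_lift a * word_lift w.
Proof.
case: w => //= b w; case: ifP => //.
by rewrite inverse_lettersE => /eqP->; rewrite letter_lift_flip mulKg.
Qed.

Lemma flift_monoid_morphism : monoid_morphism flift.
Proof.
split=> // g h; rewrite /flift /=.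
by elim: (val g) => [|a u IHu] /=; rewrite ?mul1g // word_lift_push IHu mulgA.
Qed.

HB.instance Definition _ :=
  isUMagmaMorphism.Build fgroup H flift flift_monoid_morphism.

Lemma flift_fgen i : flift (fgen i) = y i.
Proof. by rewrite /flift /= mulg1. Qed.

End Lift.

(** * Transfer between predicates on words and subgroups of the group *)

Lemma val_fgenX i n : val (fgen i ^+ n) = nseq n (i, false).
Proof.
elim: n => // n IHn; rewrite expgS /= IHn.
by case: n {IHn} => //= n; rewrite /inverse_letters andbF.
Qed.

(** The existential form also forces P to hold of reduced words only. *)
Definition represents (P : word t -> Prop) (Q : fgroup -> Prop) :=
  forall w, P w <-> exists2 g : fgroup, val g = w & Q g.

Lemma gen_represents S (Q : fgroup -> Prop) : represents S Q ->
  represents (gen S) (generated Q).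
Proof.
move=> SQ w; split.
  elim=> {w} [w /SQ[g <- Qg]||u v _ [g <- gQ] _ [h <- hQ]|u _ [g <- gQ]].
  - exists g; last exact: generated_base.
    by rewrite /fnorm fmul_nil //; apply: valP.
  - by exists 1; last exact: generated1.
  - by exists (g * h); last exact: generatedM.
  - by exists g^-1; last exact: generatedV.
case=> g <-; elim=> {w g} [g Qg||g h _ IHg _ IHh|g _ IHg].
- rewrite -[val g]fmul_nil ?valP //; apply: gen_base.
  by apply/SQ; exists g.
- exact: gen_one.
- exact: gen_mul.
- exact: gen_inv.
Qed.

Lemma Ffull_represents : represents (@Ffull t) (fun=> True).
Proof.
move=> w; split=> [Rw|[g <- _]]; last exact: valP.
by exists (exist _ w Rw).
Qed.

Lemma commsub_represents A (Q : fgroup -> Prop) : represents A Q ->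
  represents (commsub A (@Ffull t)) (commT Q).
Proof.
move=> AQ; apply: gen_represents => w; split.
  move=> [u [v [/AQ[g <- Qg] [/Ffull_represents[h <- _] ->]]]].
  by exists [~ g, h] => //; exists g, h.
move=> [_ <- [g [h [Qg ->]]]]; exists (val g), (val h); split; last first.
  by split=> //; apply: valP.
by apply/AQ; exists g.
Qed.

Lemma itcomm_represents A (Q : fgroup -> Prop) k : represents A Q ->
  represents (itcomm A k) (iter_commT Q k).
Proof. by move=> AQ; elim: k => //= k; apply: commsub_represents. Qed.

Lemma gammaE k : gamma k.+1 = itcomm (@Ffull t) k.
Proof. by rewrite /gamma /=; elim: k => //= k ->. Qed.

Lemma Rrel_represents r : represents (Rrel r) (power_closure fgen r).
Proof.
apply: gen_represents => w; split.
  move=> [s [g [[i ->] [/Ffull_represents[h <- _] ->]]]].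
  by exists ((fgen i ^+ r i) ^ h); [rewrite -val_fgenX|exists i, h].
move=> [_ <- [i [h ->]]]; exists (nseq (r i) (i, false)), (val h).
by split; [exists i|split; [apply: valP|rewrite -val_fgenX]].
Qed.

Theorem cnil_multiplier_trivial_coprime (r : 'I_t -> nat) c (i0 : 'I_t) :
    (forall i j, i != j -> coprime (r i) (r j)) ->
  cnil_multiplier_trivial r c.
Proof.
move=> co_r w Rw; rewrite gammaE.
move=> /(itcomm_represents c Ffull_represents)[g gw lc_g].
apply/(itcomm_represents c (Rrel_represents r)); exists g => //.
move: Rw => /Rrel_represents[h hw Rh].
(* The memberships in R and in gamma_(c+1) each produced a group element over w; they coincide since
   [val] is injective. *)
have -> : g = h by apply: val_inj; rewrite gw.
apply: (power_closure_lower_central i0 fgen_ind) => //; last first.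
  by rewrite -(_ : g = h) //; apply: val_inj; rewrite gw.
move=> m; exists (flift (fun i => fgen i ^+ m) : UMagmaMorphism.type _ _).
exact: flift_fgen.
Qed.

End FreeGroup.

Theorem theorem2p5 (t : nat) (r : 'I_t -> nat) :
  0 < t ->
  (forall i, 0 < r i) ->
  (forall i j : 'I_t, i != j -> coprime (r i) (r j)) ->
  forall c : nat, 0 < c ->
    cnil_multiplier_trivial r c /\
    (forall i : 'I_t, cnil_multiplier_trivial (fun _ : 'I_1 => r i) c).
Proof.
case: t r => // t r _ _ co_r c _; split.
  exact: cnil_multiplier_trivial_coprime ord0 co_r.
(* A single cyclic factor is the case of one generator, where no two indices are distinct. *)
move=> i; apply: (cnil_multiplier_trivial_coprime ord0) => j k.
by rewrite !ord1 eqxx.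
Qed.
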